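(* Let $\kappa\in(0,1]$ and $\epsilon>0$. No (possibly randomized) polynomial-time algorithm with value-oracle access achieves an approximation factor strictly better than $\frac{n^{1/2-\epsilon}}{1+(n^{1/2-\epsilon}-1)(1-\kappa)}$ for the minimum submodular $s$-$t$ cut problem with submodular functions of curvature $\kappa$: given a graph $\mathcal G=(\mathcal V,\mathcal E)$ with $n=|\mathcal V|$, distinct vertices $s,t$, and a nonnegative monotone submodular $f:2^{\mathcal E}\to\mathbb{R}$ with $f(\emptyset)=0$ and curvature $\kappa$, find an edge set $X\subseteq\mathcal E$ whose removal disconnects $s$ from $t$ minimizing $f(X)$.
   Context: In the value-oracle model the algorithm accesses $f$ only by queries returning $f(S)$; polynomial-time means polynomial in the size of the graph. Curvature: $\kappa_f = 1-\min_{e\in\mathcal E}\frac{f(e\mid \mathcal E\setminus\{e\})}{f(\{e\})}$ with $f(e\mid S)=f(S\cup\{e\})-f(S)$. *)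

(* Defs.v *)
(* World: MathComp / MathComp-Analysis. *)
From HB Require Import structures.
From mathcomp Require Import all_boot all_order all_algebra.
From mathcomp Require Import reals exp.

Set Implicit Arguments.
Unset Strict Implicit.
Unset Printing Implicit Defensive.

Import Order.TTheory GRing.Theory Num.Theory.
Local Open Scope ring_scope.

Definition nonnegative (R : realType) (E : finType) (f : {set E} -> R) : Prop :=
  forall A : {set E}, 0 <= f A.

Definition monotone (R : realType) (E : finType) (f : {set E} -> R) : Prop :=
  forall A B : {set E}, A \subset B -> f A <= f B.

Definition submodular (R : realType) (E : finType) (f : {set E} -> R) : Prop :=
  forall A B : {set E}, f (A :|: B) + f (A :&: B) <= f A + f B.

Definition gain (R : realType) (E : finType) (f : {set E} -> R)
    (e : E) (A : {set E}) : R := f (e |: A) - f A.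

(* The seed 1 of the minimum only matters when E is empty: for submodular f
   with f set0 = 0 and positive singletons every quotient is at most 1. *)
Definition curvature (R : realType) (E : finType) (f : {set E} -> R) : R :=
  1 - \big[Num.min/1]_(e : E) (gain f e (~: [set e]) / f [set e]).

(* Positive singletons make every quotient in the curvature well defined. *)
Definition has_curvature (R : realType) (E : finType) (f : {set E} -> R)
    (kappa : R) : Prop :=
  (forall e : E, 0 < f [set e]) /\ curvature f = kappa.

(* A finite simple undirected graph on the vertex set 'I_nv, given by its list
   of edges; the edge {u, v} with u < v is listed as the pair (u, v). *)
Record graph := Graph {
  nv : nat;
  ne : nat;
  ends : 'I_ne -> 'I_nv * 'I_nv;
  ends_lt : forall e : 'I_ne, ((ends e).1 < (ends e).2)%N;
  ends_inj : injective ends }.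

Definition adj_without (G : graph) (X : {set 'I_(ne G)}) : rel 'I_(nv G) :=
  fun u v => [exists e : 'I_(ne G),
    (e \notin X) && ((ends e == (u, v)) || (ends e == (v, u)))].

Definition st_cut (G : graph) (s t : 'I_(nv G)) (X : {set 'I_(ne G)}) : bool :=
  ~~ connect (adj_without X) s t.

(* The set of all edges is an s-t cut as s != t, so it may seed the minimum. *)
Definition min_cut (R : realType) (G : graph) (s t : 'I_(nv G))
    (f : {set 'I_(ne G)} -> R) : R :=
  \big[Num.min/f setT]_(X : {set 'I_(ne G)} | st_cut s t X) f X.

Record instance (R : realType) := Instance {
  gr : graph;
  src : 'I_(nv gr);
  snk : 'I_(nv gr);
  cost : {set 'I_(ne gr)} -> R }.

Definition admissible (R : realType) (kappa : R) (I : instance R) : Prop :=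
  src I != snk I /\
  [/\ nonnegative (@cost R I), monotone (@cost R I), submodular (@cost R I),
      cost (set0 : {set 'I_(ne (gr I))}) = 0
    & has_curvature (@cost R I) kappa].

(* Algorithms are programs of a randomized real RAM with a value oracle: an
   unbounded memory N of naturals, an unbounded memory X of reals (both
   initially zero), a read-only input holding the graph, s and t, fair coin
   flips, and oracle queries.  Every instruction takes unit time.  The
   naturals only support addition and truncated subtraction, so their bit length
   grows by at most one per step and polynomial time on discrete data has its
   usual meaning. *)
Inductive nat_op := NAdd | NSub.
Inductive real_op := RAdd | RSub | RMul | RDiv.

Inductive instr (R : realType) :=
| NConst of nat & nat                (* N[i] := k *)
| NOp of nat_op & nat & nat & nat    (* N[i] := N[j] op N[k] *)
| NLoad of nat & nat                 (* N[i] := N[N[j]] *)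
| NStore of nat & nat                (* N[N[i]] := N[j] *)
| NInput of nat & nat                (* N[i] := input[N[j]] *)
| NFlip of nat                       (* N[i] := a fair coin flip, 0 or 1 *)
| XConst of nat & R                  (* X[i] := c *)
| XOp of real_op & nat & nat & nat   (* X[i] := X[j] op X[k] *)
| XLoad of nat & nat                 (* X[i] := X[N[j]] *)
| XStore of nat & nat                (* X[N[i]] := X[j] *)
| XOfNat of nat & nat                (* X[i] := N[j] *)
| XQuery of nat & nat                (* X[i] := f(S), S stored at N[j] *)
| JumpN of nat & nat & nat           (* if N[i] <= N[j] goto l *)
| JumpX of nat & nat & nat           (* if X[i] <= X[j] goto l *)
| Halt.
Arguments NConst {R}. Arguments NOp {R}. Arguments NLoad {R}.
Arguments NStore {R}. Arguments NInput {R}. Arguments NFlip {R}.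
Arguments XOp {R}. Arguments XLoad {R}. Arguments XStore {R}.
Arguments XOfNat {R}. Arguments XQuery {R}. Arguments JumpN {R}.
Arguments JumpX {R}. Arguments Halt {R}.

Definition program (R : realType) := seq (instr R).

Record config (R : realType) := Config {
  pc : nat;
  nmem : nat -> nat;
  xmem : nat -> R }.

Definition upd (T : Type) (M : nat -> T) (a : nat) (v : T) : nat -> T :=
  fun b => if b == a then v else M b.

Definition eval_nat_op (o : nat_op) : nat -> nat -> nat :=
  match o with NAdd => addn | NSub => subn end.

Definition eval_real_op (R : realType) (o : real_op) (x y : R) : R :=
  match o with
  | RAdd => x + y | RSub => x - y | RMul => x * y | RDiv => x / y
  end.

Definition input (R : realType) (I : instance R) : seq nat :=
  [:: nv (gr I); ne (gr I); nat_of_ord (src I); nat_of_ord (snk I)] ++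
  flatten [seq [:: nat_of_ord (ends e).1; nat_of_ord (ends e).2]
          | e <- enum 'I_(ne (gr I))].

(* An edge set is stored at address a as its characteristic vector. *)
Definition stored_set (m : nat) (M : nat -> nat) (a : nat) : {set 'I_m} :=
  [set e : 'I_m | M (a + e)%N != 0%N].

Definition current (R : realType) (A : program R) (c : config R) : instr R :=
  nth Halt A (pc c).

Definition halted (R : realType) (A : program R) (c : config R) : bool :=
  if current A c is Halt then true else false.

(* One step; the coin is fresh at each step, and only looked at by NFlip. *)
Definition step (R : realType) (A : program R) (I : instance R)
    (c : config R) (coin : bool) : config R :=
  let N := nmem c in let X := xmem c in
  let setN := fun i v => Config (pc c).+1 (upd N i v) X in
  let setX := fun i x => Config (pc c).+1 N (upd X i x) in
  let jump := fun (b : bool) l => Config (if b then l else (pc c).+1) N X in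
  match current A c with
  | NConst i k => setN i k
  | NOp o i j k => setN i (eval_nat_op o (N j) (N k))
  | NLoad i j => setN i (N (N j))
  | NStore i j => setN (N i) (N j)
  | NInput i j => setN i (nth 0%N (input I) (N j))
  | NFlip i => setN i (nat_of_bool coin)
  | XConst i x => setX i x
  | XOp o i j k => setX i (eval_real_op o (X j) (X k))
  | XLoad i j => setX i (X (N j))
  | XStore i j => setX (N i) (X j)
  | XOfNat i j => setX i (N j)%:R
  | XQuery i j => setX i (cost (stored_set (ne (gr I)) N (N j)))
  | JumpN i j l => jump (N i <= N j)%N l
  | JumpX i j l => jump (X i <= X j) l
  | Halt => c
  end.

Definition run (R : realType) (A : program R) (I : instance R)
    (w : seq bool) : config R :=
  foldl (step A I) (Config 0 (fun=> 0%N) (fun=> 0)) w.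

Definition output (R : realType) (A : program R) (I : instance R)
    (w : seq bool) : {set 'I_(ne (gr I))} :=
  let M := nmem (run A I w) in stored_set (ne (gr I)) M (M 0%N).

Definition time_bound (c : nat) (G : graph) : nat := (c * (nv G + ne G) ^ c)%N.

(* A halts on every admissible instance, for every outcome of the coins, within
   c * (size of the graph) ^ c steps. *)
Definition polynomial_time (R : realType) (kappa : R) (A : program R) (c : nat)
    : Prop :=
  forall I : instance R, admissible kappa I ->
  forall w : (time_bound c (gr I)).-tuple bool, halted A (run A I w).

Definition prob (R : realType) (T : nat) (P : pred (T.-tuple bool)) : R :=
  #|P|%:R / 2 ^+ T.

Definition expect (R : realType) (T : nat) (F : T.-tuple bool -> R) : R :=
  (\sum_(w : T.-tuple bool) F w) / 2 ^+ T.

Definition opt (R : realType) (I : instance R) : R :=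
  min_cut (src I) (snk I) (@cost R I).

Definition approximates_in_expectation (R : realType) (kappa : R)
    (A : program R) (c : nat) (rho : nat -> R) : Prop :=
  forall I : instance R, admissible kappa I ->
  let T := time_bound c (gr I) in
  (forall w : T.-tuple bool, st_cut (src I) (snk I) (output A I w)) /\
  expect (fun w : T.-tuple bool => cost (output A I w))
    <= rho (nv (gr I)) * opt I.

Definition approximates_with_prob (R : realType) (kappa p : R)
    (A : program R) (c : nat) (rho : nat -> R) : Prop :=
  forall I : instance R, admissible kappa I ->
  let T := time_bound c (gr I) in
  p <= prob R (fun w : T.-tuple bool =>
         st_cut (src I) (snk I) (output A I w) &&
         (cost (output A I w) <= rho (nv (gr I)) * opt I)).

(* The two usual guarantees of a randomized algorithm: in expectation, or with
   at least some constant probability; both cover deterministic algorithms. *)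
Definition achieves (R : realType) (kappa : R) (A : program R) (c : nat)
    (rho : nat -> R) : Prop :=
  approximates_in_expectation kappa A c rho \/
  exists2 p : R, 0 < p & approximates_with_prob kappa p A c rho.

Definition hardness_factor (R : realType) (kappa eps : R) (n : nat) : R :=
  let y := n%:R `^ (2^-1 - eps) in y / (1 + (y - 1) * (1 - kappa)).

(* Main.v *)
(* Hide a cheap cut in a graph made of q disjoint s-t paths of q edges each.
   Let R consist of one uniformly random edge of every path.  The cost
     (1 - kappa) |S| + kappa min (q, |S \ R| + min (|S /\ R|, b))
   has curvature kappa and gives the cut R at most (1 - kappa) q + kappa b,
   while (1 - kappa) |S| + kappa min (q, |S|) gives every cut at least q.  The
   two costs differ only at sets S with |S /\ R| > b and |S| <= 2 q; as |S /\ R|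
   has mean |S| / q <= 2 and independent contributions of the paths, a fixed S is
   such a set with probability at most e^2 / 2^b.  By a union bound over the
   queries, some R is noticed by a polynomial-time algorithm with probability
   only poly(b) / 2^b, for q a fixed power of b.  Since the graph has about q^2
   vertices, q / b exceeds n^(1/2 - eps) as soon as that power is large. *)
Require Import Defs.
From mathcomp Require Import all_boot all_order all_algebra.
From mathcomp Require Import reals sequences exp zify lra ring.
Import Order.TTheory GRing.Theory Num.Theory.
Local Open Scope ring_scope.

Set Implicit Arguments.
Unset Strict Implicit.
Unset Printing Implicit Defensive.

Section Rank.
Local Open Scope nat_scope.
Variable E : finType.
Implicit Types (A B R : {set E}) (f : {set E} -> nat).

Definition submodular_nat f : Prop :=
  {homo f : A B / A \subset B >-> A <= B} /\
  forall A B, f (A :|: B) + f (A :&: B) <= f A + f B.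

Lemma submodular_nat_minn f a :
  submodular_nat f -> submodular_nat (fun A => minn (f A) a).
Proof.
move=> [mf sf]; split=> [A B /mf AB | A B]; first by lia.
have := sf A B; have := mf _ _ (subsetIl A B); have := mf _ _ (subsetIr A B).
have := mf _ _ (subsetUl A B); have := mf _ _ (subsetUr A B); lia.
Qed.

Lemma submodular_nat_add f g :
  submodular_nat f -> submodular_nat g -> submodular_nat (fun A => f A + g A).
Proof.
move=> [mf sf] [mg sg]; split=> [A B AB | A B].
  by rewrite leq_add ?mf ?mg.
by have := sf A B; have := sg A B; lia.
Qed.

Lemma submodular_nat_cardI R : submodular_nat (fun A => #|A :&: R|).
Proof.
split=> [A B AB | A B]; first by rewrite subset_leq_card ?setSI.
by rewrite setIUl setIIl cardsUI.
Qed.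

Definition planted_rank R b q A := minn (#|A :\: R| + minn #|A :&: R| b) q.

Lemma submodular_planted_rank R b q : submodular_nat (planted_rank R b q).
Proof.
apply: submodular_nat_minn; apply: submodular_nat_add.
  have [m s] := submodular_nat_cardI (~: R).
  by split=> [A B AB|A B]; rewrite !setDE; [apply: m|apply: s].
exact/submodular_nat_minn/submodular_nat_cardI.
Qed.

Lemma planted_rank0 R b q : planted_rank R b q set0 = 0.
Proof. by rewrite /planted_rank set0D set0I cards0 min0n min0n. Qed.

Lemma planted_rank1 R b q e :
  0 < b -> 0 < q -> planted_rank R b q [set e] = 1.
Proof.
move=> b0 q0; have := cardsID R [set e]; rewrite cards1 /planted_rank; lia.
Qed.

Lemma planted_rank_self R b q : planted_rank R b q R <= b.
Proof. by rewrite /planted_rank setDv cards0; lia. Qed.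

Lemma planted_rank_full R b q A :
  q <= #|A :\: R| -> planted_rank R b q A = q.
Proof. by rewrite /planted_rank; lia. Qed.

Lemma planted_rankP R b q A :
  planted_rank R b q A != minn #|A| q ->
  (b < #|A :&: R|) && (#|A| < q + #|R|).
Proof.
have := cardsID R A; have := subset_leq_card (subsetIr A R).
rewrite /planted_rank; lia.
Qed.

End Rank.

Section Cost.
Variables (K : realType) (E : finType) (kappa : K).
Implicit Types (A R : {set E}).

Definition mixed_cost (g : {set E} -> nat) A : K :=
  (1 - kappa) * #|A|%:R + kappa * (g A)%:R.

Hypotheses (kappa_gt0 : 0 < kappa) (kappa_le1 : kappa <= 1).

Lemma mixed_cost_submodular g : submodular_nat g ->
  [/\ nonnegative (mixed_cost g), monotone (mixed_cost g)
    & submodular (mixed_cost g)].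
Proof.
move=> [mg sg]; have k0 : 0 <= 1 - kappa by rewrite subr_ge0.
have k1 := ltW kappa_gt0.
split=> [A | A B AB | A B]; rewrite /mixed_cost.
- by rewrite addr_ge0 ?mulr_ge0 ?ler0n.
- by rewrite lerD ?ler_wpM2l ?ler_nat ?subset_leq_card ?mg.
- rewrite addrACA -!mulrDr -!natrD [leRHS]addrACA -!mulrDr -!natrD.
  by rewrite lerD ?ler_wpM2l ?ler_nat ?cardsUI ?sg.
Qed.

Definition planted_cost R b q := mixed_cost (planted_rank R b q).

Lemma planted_cost_curvature R b q (e0 : E) :
  (0 < b)%N -> (0 < q)%N -> (q < #|~: R|)%N ->
  has_curvature (planted_cost R b q) kappa.
Proof.
move=> b0 q0 qR.
have c1 e : planted_cost R b q [set e] = 1.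
  by rewrite /planted_cost /mixed_cost cards1 planted_rank1 //; lra.
split=> [e|]; first by rewrite c1.
have gE e : gain (planted_cost R b q) e (~: [set e])
    / planted_cost R b q [set e] = 1 - kappa.
  have qe : (q <= #|~: [set e] :\: R|)%N.
    rewrite setDE setIC -setDE.
    have := cardsD1 e (~: R); lia.
  rewrite c1 divr1 /gain setUCr /planted_cost /mixed_cost !planted_rank_full //.
    by rewrite (cardsD1 e [set: E]) inE setTD add1n -natr1; ring.
  by rewrite setTD ltnW.
rewrite /curvature (eq_bigr (fun=> 1 - kappa)) => [|e _]; last exact: gE.
suff -> : \big[Num.min/1]_(e : E) (1 - kappa) = 1 - kappa by ring.
apply/le_anti/andP; split; first exact: bigmin_le e0 _.
by apply: le_bigmin => //; rewrite gerBl ltW.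
Qed.

End Cost.

Section Paths.
Local Open Scope nat_scope.
Variable q : nat.
Hypothesis q_gt1 : (1 < q).
Implicit Types (e : 'I_(q * q)) (i j : 'I_q).

Fact edge_row_subproof e : (e %/ q < q).
Proof. by rewrite ltn_divLR ?ltn_ord // ltnW. Qed.

Fact edge_subproof i j : (i * q + j < q * q).
Proof. by clear q_gt1; have := ltn_ord i; have := ltn_ord j; nia. Qed.

Definition edge_row e : 'I_q := Ordinal (edge_row_subproof e).
Definition edge_at (p : 'I_q * 'I_q) : 'I_(q * q) :=
  Ordinal (edge_subproof p.1 p.2).

(* Edge [i * q + j] is the j-th edge of the i-th path and joins the vertices
   [i * q + j] and [i * q + j + 1], except that each path starts at [s = 0] and
   ends at [t = q * q]; the nonzero multiples of [q] below [q * q] are isolated. *)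
Definition edge_tail e : 'I_(q * q).+1 := inord (if q %| e then 0 else e).
Definition edge_head e : 'I_(q * q).+1 :=
  inord (if q %| e.+1 then q * q else e.+1).

Lemma edge_tailE e : edge_tail e = (if q %| e then 0 else e) :> nat.
Proof. by rewrite inordK; case: ifP => //; have := ltn_ord e; lia. Qed.

Lemma edge_headE e : edge_head e = (if q %| e.+1 then q * q else e.+1) :> nat.
Proof. by rewrite inordK; case: ifP => //; have := ltn_ord e; lia. Qed.

Lemma edge_tail_lt_head e : (edge_tail e < edge_head e).
Proof.
by rewrite edge_tailE edge_headE; have := ltn_ord e; do 2!case: ifP; lia.
Qed.

Lemma edge_ends_inj : injective (fun e => (edge_tail e, edge_head e)).
Proof.
move=> e e' [/(congr1 val) /= + /(congr1 val) /=].
rewrite !edge_tailE !edge_headE => t h; apply: val_inj => /=; move: t h.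
have nd (a : nat) : (q %| a -> ~~ (q %| a.+1)).
  by move=> qa; rewrite -addn1 dvdn_addr // gtnNdvd.
case: ifP => [/nd/negPf -> | qe].
  case: ifP => [/nd/negPf -> _ [] // | qe'].
  by move=> e0; rewrite -e0 dvdn0 in qe'.
by case: ifP => // qe' e0; rewrite e0 dvdn0 in qe.
Qed.

Definition path_graph : graph :=
  @Graph (q * q).+1 (q * q) (fun e => (edge_tail e, edge_head e))
    edge_tail_lt_head edge_ends_inj.

Definition path_src : 'I_(nv path_graph) := ord0.
Definition path_snk : 'I_(nv path_graph) := ord_max.

Lemma path_src_neq_snk : path_src != path_snk.
Proof. by rewrite -val_eqE /= eq_sym -lt0n muln_gt0 ltnW. Qed.

Lemma edge_atK p : edge_row (edge_at p) = p.1 /\ (edge_at p %% q) = p.2.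
Proof.
split; last by rewrite /= modnMDl modn_small.
by apply: val_inj; rewrite /= divnMDl ?divn_small ?addn0 // ltnW.
Qed.

Lemma edge_at_bij : bijective edge_at.
Proof.
have q0 : (0 < q) := ltnW q_gt1.
exists (fun e => (edge_row e, Ordinal (ltn_pmod e q0))) => [p|e].
  have [r c] := edge_atK p; case: p r c => i j /= r c.
  by congr pair => //; apply: val_inj.
by apply: val_inj; rewrite /= -divn_eq.
Qed.

Definition row_transversal (r : {ffun 'I_q -> 'I_q}) :
    {set 'I_(ne path_graph)} :=
  [set edge_at (i, r i) | i : 'I_q].

Lemma edge_row_at i j : edge_row (edge_at (i, j)) = i.
Proof. by have [] := edge_atK (i, j). Qed.

Lemma edge_at_row_inj (r : {ffun 'I_q -> 'I_q}) :
  injective (fun i => edge_at (i, r i)).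
Proof. by move=> i j /(congr1 edge_row); rewrite !edge_row_at. Qed.

Lemma card_row_transversal r : #|row_transversal r| = q.
Proof. by rewrite card_imset ?card_ord //; exact: edge_at_row_inj. Qed.

Lemma card_row_transversalI r (S : {set 'I_(q * q)}) :
  #|S :&: row_transversal r| = (\sum_i (edge_at (i, r i) \in S)).
Proof.
have -> : S :&: row_transversal r =
    [set edge_at (i, r i) | i in [pred i | edge_at (i, r i) \in S]].
  apply/setP => e; rewrite inE; apply/andP/imsetP.
    by move=> [eS /imsetP[i _ ei]]; exists i => //; rewrite inE -ei.
  move=> [i]; rewrite inE => iS ->; split=> //; exact: imset_f.
rewrite card_imset; last exact: edge_at_row_inj.
by rewrite -sum1_card big_mkcond; apply: eq_bigr => i _; rewrite inE; case: (_ \in S).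
Qed.

Lemma row_transversal_cut r : st_cut path_src path_snk (row_transversal r).
Proof.
have q0 : (0 < q) := ltnW q_gt1.
pose a : {pred 'I_(q * q).+1} := fun v =>
  [exists i : 'I_q, (v %/ q == i) && (v %% q <= r i)].
have aE (v : 'I_(q * q).+1) (i : 'I_q) :
    v %/ q = i -> (v \in a) = (v %% q <= r i).
  move=> vi; apply/existsP/idP => [[i' /andP[/eqP vi']]|ri].
    by have -> : i' = i by apply: val_inj; rewrite /= -vi vi'.
  by exists i; rewrite vi eqxx.
have aT (v : 'I_(q * q).+1) : v = q * q :> nat -> v \in a = false.
  move=> vq; apply/negbTE/existsPn => i.
  by rewrite vq mulnK // gtn_eqF.
(* [a] is the side of s: the vertices at or before the removed edge of a path. *)
suff cl : closed (adj_without (row_transversal r)) a.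
  apply/negP => /(closed_connect cl).
  by rewrite (aT path_snk) // (aE path_src (Ordinal q0)) /= ?mod0n ?div0n.
have ae e : e \notin row_transversal r ->
    (edge_tail e \in a) = (edge_head e \in a).
  move=> eR.
  have ne : e %% q != r (edge_row e).
    apply: contra eR => /eqP er; apply/imsetP; exists (edge_row e) => //.
    by apply: val_inj; rewrite /= -er -divn_eq.
  have cq := ltn_pmod e q0.
  have -> : (edge_tail e \in a) = (e %% q <= r (edge_row e)).
    have := edge_tailE e; case: ifP => [/eqP -> t0|_ te].
      by rewrite (aE _ (Ordinal q0)) t0 ?mod0n ?div0n.
    by rewrite (aE _ (edge_row e)) te.
  have := edge_headE e; case: ifP => [qe hq|qe he].
    rewrite (aT (edge_head e)) //; apply/negbTE; rewrite -ltnNge.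
    have : e %% q = q.-1.
      move: qe; rewrite {1}(divn_eq e q) -addnS.
      rewrite dvdn_addr ?dvdn_mull // => /dvdn_leq; lia.
    by move: ne; have := ltn_ord (r (edge_row e)); lia.
  have mS : e.+1 %% q = (e %% q).+1.
    rewrite -addn1 -modnDml addn1 modn_small //.
    move: cq; rewrite leq_eqVlt => /orP[/eqP eq|//].
    by move: qe; rewrite (divn_eq e q) -addnS eq dvdn_addr ?dvdn_mull ?dvdnn.
  have dS : e.+1 %/ q = e %/ q.
    by have := divn_eq e q; have := divn_eq e.+1 q; rewrite mS; nia.
  by rewrite (aE _ (edge_row e)) he ?dS // mS; lia.
move=> u v /existsP[e /andP[eR]] /=.
by move=> /orP[]/eqP[<- <-]; rewrite ae.
Qed.

Lemma st_cut_card (X : {set 'I_(ne path_graph)}) :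
  st_cut path_src path_snk X -> (q <= #|X|).
Proof.
move=> cX; rewrite -[leqLHS]card_ord.
suff rowX i : i \in edge_row @: X.
  rewrite (leq_trans _ (leq_imset_card edge_row X)) //.
  by apply/subset_leq_card/subsetP => i _; exact: rowX.
have q0 : (0 < q) := ltnW q_gt1.
apply: contraNT cX => iX.
pose v (j : nat) : 'I_(q * q).+1 :=
  inord (if j == 0 then 0 else if j == q then q * q else i * q + j).
have vE (j : nat) (jq : j < q) : v j = edge_tail (edge_at (i, Ordinal jq)).
  rewrite /v /edge_tail /= dvdn_addr ?dvdn_mull // (ltn_eqF jq).
  case: eqP => [->|/eqP]; first by rewrite dvdn0.
  by rewrite -lt0n => j0; rewrite gtnNdvd.
have vS (j : nat) (jq : j < q) : v j.+1 = edge_head (edge_at (i, Ordinal jq)).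
  rewrite /v /edge_head /= -addnS dvdn_addr ?dvdn_mull //.
  by have [->|jq'] := eqVneq j.+1 q; rewrite ?dvdnn // gtnNdvd // ltn_neqAle jq'.
have path_to (j : nat) : j <= q -> connect (adj_without X) (v 0) (v j).
  elim: j => [|j IH] jq; first exact: connect0.
  apply: connect_trans (IH (ltnW jq)) _; apply: connect1.
  apply/existsP; exists (edge_at (i, Ordinal jq)).
  rewrite /= -vE -vS eqxx andbT; apply: contra iX => eX.
  by apply/imsetP; exists (edge_at (i, Ordinal jq)) => //; rewrite edge_row_at.
have := path_to q (leqnn q).
have -> : v 0 = path_src by apply: val_inj; rewrite /= inordK.
suff -> : v q = path_snk by [].
by apply: val_inj; rewrite /= /v eqxx gtn_eqF // inordK.
Qed.

End Paths.

Section Concentration.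
Variables (K : realType) (q : nat).
Hypothesis q_gt1 : (1 < q)%N.

(* Exponential moment bound: the rows of a uniform transversal are independent,
   so [2 ^ #|S :&: row_transversal r|] averages to at most [expR (#|S| / q)]. *)
Lemma row_transversal_tail (S : {set 'I_(q * q)}) (b : nat) :
  (#|S| <= 2 * q)%N ->
  #|[pred r | b < #|S :&: row_transversal q_gt1 r|]%N|%:R * 2 ^+ b
    <= expR 2 * #|{ffun 'I_q -> 'I_q}|%:R :> K.
Proof.
move=> Sq; have q0 : 0 < q%:R :> K by rewrite ltr0n ltnW.
pose x i j := (edge_at (i, j) \in S : nat).
apply: (@le_trans _ _
    (\sum_(r : {ffun 'I_q -> 'I_q}) \prod_i (2 : K) ^+ x i (r i))).
  rewrite -sum1_card natr_sum mulr_suml big_mkcond /=; apply: ler_sum => r _.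
  rewrite inE.
  case: ifP => [|_]; last by apply: prodr_ge0 => i _; rewrite exprn_ge0.
  by rewrite card_row_transversalI mul1r prodrXr ler_eXn2l ?ltr1n // => /ltnW.
rewrite -(bigA_distr_bigA (fun i j => (2 : K) ^+ x i j)).
have rowE i : \sum_j (2 : K) ^+ x i j = q%:R + (\sum_j x i j)%:R.
  rewrite natr_sum -[X in X%:R + _]card_ord -sumr_const -big_split /=.
  by apply: eq_bigr => j _; rewrite /x; case: (_ \in S); rewrite ?expr1 ?addr0.
have sumE : (\sum_i \sum_j x i j = #|S|)%N.
  rewrite pair_big /= -sum1_card [RHS]big_mkcond /=.
  rewrite (reindex (@edge_at q)) /=; last exact/onW_bij/edge_at_bij.
  by apply: eq_bigr => -[i j] _; rewrite /x /=; case: (_ \in S).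
apply: (@le_trans _ _
    (\prod_(i : 'I_q) (expR ((\sum_j x i j)%:R / q%:R) * q%:R))).
  apply: ler_prod => i _; rewrite rowE addr_ge0 ?ler0n //=.
  rewrite -ler_pdivrMr // mulrDl divff ?gt_eqF //.
  exact: expR_ge1Dx.
rewrite big_split /= prodr_const card_ord card_ffun card_ord natrX.
rewrite ler_wpM2r ?exprn_ge0 ?(ltW q0) // -expR_sum ler_expR.
by rewrite -mulr_suml -natr_sum sumE ler_pdivrMr // -natrM ler_nat.
Qed.

End Concentration.

Section Simulation.
Variables (K : realType) (A : program K).

Definition query_set (m : nat) (c : config K) : {set 'I_m} :=
  if current A c is XQuery _ j then stored_set m (nmem c) (nmem c j) else set0.

Lemma run_indistinguishable (G : graph) (s t : 'I_(nv G))
    (f g : {set 'I_(ne G)} -> K) (w : seq bool) :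
  (forall k, (k < size w)%N ->
    let S := query_set (ne G) (run A (Instance s t g) (take k w)) in
    f S = g S) ->
  run A (Instance s t f) w = run A (Instance s t g) w.
Proof.
elim/last_ind: w => [//|w x IH] fg.
have runS h : run A (Instance s t h) (rcons w x) =
    step A (Instance s t h) (run A (Instance s t h) w) x.
  by rewrite /run foldl_rcons.
rewrite !runS IH => [|k kw]; last first.
  have := fg k; rewrite size_rcons ltnS (ltnW kw) => /(_ isT).
  by rewrite -cats1 takel_cat // ltnW.
have := fg (size w); rewrite size_rcons ltnSn => /(_ isT) /=.
rewrite -cats1 take_size_cat // /query_set /step.
by case: (current A _) => //= i j ->.
Qed.

End Simulation.

Lemma exists_le_average (K : numFieldType) (I J : finType) (B : I -> J -> bool)
    (d : K) (i0 : I) :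
  (forall j, #|[pred i | B i j]|%:R <= d) ->
  exists i, #|[pred j | B i j]|%:R * #|I|%:R <= d * #|J|%:R.
Proof.
move=> Bd.
have total : \sum_i #|[pred j | B i j]|%:R <= d * #|J|%:R :> K.
  rewrite (eq_bigr (fun i => \sum_j (B i j)%:R)) => [|i _]; last first.
    by rewrite -sum1_card natr_sum big_mkcond /=; apply: eq_bigr => j _;
      rewrite inE; case: (B i j).
  rewrite exchange_big mulr_natr -sumr_const; apply: ler_sum => j _.
  apply: le_trans (Bd j); rewrite -sum1_card natr_sum [leRHS]big_mkcond /=.
  by apply: ler_sum => i _; rewrite inE; case: (B i j).
have [i _ min_i] := arg_minnP (fun i => #|[pred j | B i j]|) (erefl (i0 \in I)).
exists i; apply: le_trans total; rewrite mulr_natr -sumr_const.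
by apply: ler_sum => i' _; rewrite ler_nat min_i.
Qed.

Lemma ltn_poly_exp2 (C D n0 : nat) :
  exists2 b, (n0 <= b)%N & (C * b ^ D < 2 ^ b)%N.
Proof.
pose d := (C * D.+1 ^ D + n0).+1; exists (D.+1 * d)%N; first by rewrite /d; nia.
apply: (@leq_trans (d ^ D.+1)).
  by rewrite expnMn mulnA expnS ltn_pmul2r ?expn_gt0 //; rewrite /d; lia.
by rewrite mulnC expnM leq_exp2r // ltnW // ltn_expl.
Qed.

Lemma hidden_cut (K : realType) (kappa : K) (A : program K) (T q b : nat)
    (q_gt1 : (1 < q)%N) :
  0 < kappa -> kappa <= 1 -> (2 < q)%N -> (0 < b)%N ->
  exists cst : {set 'I_(ne (path_graph q_gt1))} -> K,
    let I := Instance (path_src q_gt1) (path_snk q_gt1) cst in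
    [/\ admissible kappa I, opt I <= (1 - kappa) * q%:R + kappa * b%:R
      & prob K (fun w : T.-tuple bool =>
          st_cut (src I) (snk I) (output A I w) &&
          (cost (output A I w) < q%:R)) <= T.+1%:R * expR 2 / 2 ^+ b].
Proof.
move=> k0 k1 q2 b0.
pose E := 'I_(ne (path_graph q_gt1)).
pose base : {set E} -> K := mixed_cost kappa (fun A => minn #|A| q).
pose planted r : {set E} -> K :=
  planted_cost kappa (row_transversal q_gt1 r) b q.
pose I0 := Instance (path_src q_gt1) (path_snk q_gt1) base.
pose Q (w : T.-tuple bool) (i : 'I_T.+1) : {set E} :=
  if (i < T)%N then query_set A (ne (gr I0)) (run A I0 (take i w))
  else output A I0 w.
pose differ r w := [exists i, planted r (Q w i) != base (Q w i)].
pose r0 : {ffun 'I_q -> 'I_q} := [ffun i => i].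
have two_b : 0 < 2 ^+ b :> K by rewrite exprn_gt0.
have [w|r rP] := @exists_le_average K _ _ differ
    (T.+1%:R * (expR 2 * #|{ffun 'I_q -> 'I_q}|%:R / 2 ^+ b)) r0.
  have hit i : #|[pred r | planted r (Q w i) != base (Q w i)]|%:R
      <= expR 2 * #|{ffun 'I_q -> 'I_q}|%:R / 2 ^+ b :> K.
    have [small|large] := leqP #|Q w i| (2 * q).
      rewrite ler_pdivlMr //; apply: le_trans _ (row_transversal_tail K q_gt1 b small).
      rewrite (ler_wpM2r (ltW two_b)) // ler_nat; apply/subset_leq_card/subsetP => r.
      rewrite !inE; apply: contraR => nb; apply/eqP.
      congr (_ + _ * _%:R); apply/eqP; apply: contraR nb => /planted_rankP.
      by case/andP.
    rewrite eq_card0 ?mulr_ge0 ?invr_ge0 ?expR_ge0 ?(ltW two_b) // => r.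
    rewrite !inE; apply/negbTE; rewrite negbK; apply/eqP.
    congr (_ + _ * _%:R); apply/eqP; apply: contraTT large => /planted_rankP.
    by rewrite card_row_transversal -leqNgt addnn -mul2n => /andP[_ /ltnW].
  apply: (@le_trans _ _ (\sum_i
      #|[pred r | planted r (Q w i) != base (Q w i)]|%:R)); last first.
    rewrite mulr_natl -[X in _ *+ X]card_ord -sumr_const.
    by apply: ler_sum => i _; exact: hit.
  rewrite -natr_sum ler_nat -sum1_card.
  rewrite (eq_bigr (fun i => \sum_r (planted r (Q w i) != base (Q w i)))%N);
    last first.
    by move=> i _; rewrite -sum1_card big_mkcond; apply: eq_bigr => r _;
      rewrite inE; case: (_ != _).
  rewrite exchange_big big_mkcond; apply: leq_sum => r _ /=.
  rewrite inE; case: ifP => // /existsP[i ri].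
  by rewrite (bigD1 i) //= ri.
exists (planted r) => I; split.
- split; first exact: path_src_neq_snk.
  have [nn mn sm] := mixed_cost_submodular k0 k1
    (submodular_planted_rank (row_transversal q_gt1 r) b q).
  split=> //=.
    by rewrite /planted /planted_cost /mixed_cost planted_rank0 cards0 !mulr0 addr0.
  have e0 : E := edge_at (Ordinal q_gt1, Ordinal q_gt1).
  apply: planted_cost_curvature e0 _ _ _ => //; first lia.
  rewrite -(ltn_add2l q) -[X in (_ < X + _)%N](card_row_transversal q_gt1 r).
  by rewrite cardsC card_ord /=; nia.
- apply: le_trans (bigmin_le_cond _ _ (row_transversal_cut q_gt1 r)) _.
  rewrite /= /planted /planted_cost /mixed_cost card_row_transversal lerD2l.
  by rewrite (ler_wpM2l (ltW k0)) // ler_nat planted_rank_self.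
rewrite /prob.
have ffun0 : 0 < #|{ffun 'I_q -> 'I_q}|%:R :> K.
  by rewrite ltr0n; apply/card_gt0P; exists r0.
have twoT : 0 < 2 ^+ T :> K by rewrite exprn_gt0.
rewrite ler_pdivrMr //.
apply: (@le_trans _ _ (#|[pred w | differ r w]|%:R)); last first.
  rewrite -(ler_pM2r ffun0) (le_trans rP) // card_tuple card_bool natrX.
  by rewrite le_eqVlt; apply/orP; left; apply/eqP; ring.
rewrite ler_nat; apply/subset_leq_card/subsetP => w; rewrite !inE.
apply: contraTT; rewrite negb_exists => /forallP same.
have runE : run A I w = run A I0 w.
  apply: run_indistinguishable => j; rewrite size_tuple => jT /=.
  have := same (Ordinal (leqW jT)); rewrite negbK /Q /= jT => /eqP.
  exact.
have outE : output A I w = output A I0 w by rewrite /output /= runE.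
have := same ord_max; rewrite negbK /Q ltnn => /eqP costE.
rewrite -topredE /= -/(output A I w) outE; apply/negP => /andP[cut].
rewrite costE.
have qX := st_cut_card cut.
rewrite /base /mixed_cost (minn_idPr qX) ltNge => /negP; apply.
have : q%:R <= #|output A I0 w|%:R :> K by rewrite ler_nat.
nra.
Qed.

Lemma hidden_instance (K : realType) (kappa eta : K) (A : program K)
    (c k n0 : nat) :
  0 < kappa -> kappa <= 1 -> 0 < eta ->
  exists (I : instance K) (b : nat),
    [/\ admissible kappa I, (n0 <= nv (gr I) <= b ^ (2 * k + 6))%N, (1 < b)%N,
        opt I <= (1 - kappa) * (b ^ k.+2)%:R + kappa * b%:R
      & prob K (fun w : (time_bound c (gr I)).-tuple bool =>
          st_cut (src I) (snk I) (output A I w) &&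
          (cost (output A I w) < (b ^ k.+2)%:R)) < eta / (b ^ k)%:R].
Proof.
move=> k0 k1 eta0.
have [M M_gt] : exists M : nat, expR 2 / eta < M%:R.
  by exists (Num.truncn (expR 2 / eta)).+1; exact: truncnS_gt.
have [b] := ltn_poly_exp2 ((c * 3 ^ c).+1 * M) (2 * k.+2 * c + k) (n0 + 2).
move=> b_ge b_lt; have b1 : (1 < b)%N by lia.
have qb : (b ^ 2 <= b ^ k.+2)%N by rewrite leq_exp2l.
have q2 : (2 < b ^ k.+2)%N by apply: leq_trans qb; nia.
have q1 := ltnW q2.
have [cst [adm optI probI]] := hidden_cut A
  (time_bound c (path_graph q1)) q1 k0 k1 q2 (ltnW b1).
exists (Instance (path_src q1) (path_snk q1) cst), b; split=> //.
  apply/andP; split; rewrite /=.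
    have bb : (b <= b ^ 2)%N by rewrite -[leqLHS]expn1 leq_exp2l.
    by set q := (b ^ k.+2)%N in qb *; nia.
  have -> : (2 * k + 6 = 2 + k.+2 * 2)%N by lia.
  by rewrite expnD expnM; set q := (b ^ k.+2)%N in qb *; nia.
apply: le_lt_trans probI _; set T := time_bound _ _.
have q_gt0 : (0 < b ^ k.+2)%N by lia.
have bk_gt0 : (0 < b ^ k)%N by rewrite expn_gt0 ltnW.
have T_le : (T.+1 * M * b ^ k < 2 ^ b)%N.
  apply: leq_ltn_trans b_lt; rewrite expnD mulnA leq_mul2r.
  apply/orP; right; rewrite mulnAC leq_mul2r; apply/orP; right.
  have -> : (b ^ (2 * k.+2 * c) = ((b ^ k.+2) ^ 2) ^ c)%N.
    by rewrite -!expnM mulnA (mulnC k.+2).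
  rewrite /T /time_bound /=; set q := (b ^ k.+2)%N in q2 *.
  have : ((c * ((q * q).+1 + q * q) ^ c) <= c * 3 ^ c * (q ^ 2) ^ c)%N.
    rewrite -mulnA -expnMn leq_mul2l.
    by case: (c) => [//|c']; rewrite leq_exp2r //; nia.
  have : (0 < (q ^ 2) ^ c)%N by rewrite !expn_gt0; lia.
  set x := ((q ^ 2) ^ c)%N; set y := (c * 3 ^ c)%N; nia.
rewrite ltr_pdivrMr ?exprn_gt0 // mulrAC ltr_pdivlMr ?ltr0n //.
apply: (@le_lt_trans _ _ ((T.+1 * M * b ^ k)%:R * eta)).
  have M_ge : expR 2 <= M%:R * eta by rewrite -ler_pdivrMr // ltW.
  have -> : (T.+1 * M * b ^ k)%:R * eta = T.+1%:R * (b ^ k)%:R * (M%:R * eta).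
    by rewrite !natrM; ring.
  by rewrite mulrAC ler_wpM2l // mulr_ge0.
by rewrite mulrC ltr_pM2l // -natrX ltr_nat.
Qed.

Lemma root_le_hidden_size (K : realType) (eps : K) (b k n : nat) :
  3 / (2 * k + 6)%:R <= eps -> (0 < n <= b ^ (2 * k + 6))%N ->
  n%:R `^ (2^-1 - eps) <= (b ^ k)%:R.
Proof.
move=> eps_ge /andP[n0 nb].
have D0 : 0 < (2 * k + 6)%:R :> K by rewrite ltr0n; lia.
have n1 : 1 <= n%:R :> K by rewrite ler1n.
apply: (@le_trans _ _ (n%:R `^ (k%:R / (2 * k + 6)%:R))).
  apply: ler_powR => //; suff -> : k%:R / (2 * k + 6)%:R =
    2^-1 - 3 / (2 * k + 6)%:R :> K by rewrite lerD2l lerN2.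
  by move: D0; rewrite natrD natrM => /lt0r_neq0 D0; field.
apply: (@le_trans _ _ ((b ^ (2 * k + 6))%:R `^ (k%:R / (2 * k + 6)%:R))).
  by apply: ge0_ler_powR; rewrite ?nnegrE ?divr_ge0 ?ler0n ?ler_nat.
rewrite natrX -powR_mulrn // -powRrM mulrCA divff ?lt0r_neq0 // mulr1.
by rewrite powR_mulrn // natrX.
Qed.

Lemma ratio_mono (K : realFieldType) (kappa y Y : K) :
  0 < kappa -> kappa <= 1 -> 0 < y -> y <= Y ->
  y / (1 + (y - 1) * (1 - kappa)) <= Y / (1 + (Y - 1) * (1 - kappa)).
Proof.
move=> k0 k1 y0 yY.
have den z : 0 < z -> 0 < 1 + (z - 1) * (1 - kappa) by move=> z0; nra.
rewrite ler_pdivrMr ?den // mulrAC ler_pdivlMr ?den //; last lra.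
nra.
Qed.

Lemma scaled_opt_le (K : realType) (kappa rho Y b : K) (o : K) :
  0 < kappa -> kappa <= 1 -> 1 <= Y -> 2 <= b -> 0 <= o ->
  rho <= Y / (1 + (Y - 1) * (1 - kappa)) ->
  o <= (1 - kappa) * (b ^+ 2 * Y) + kappa * b ->
  rho * o <= b ^+ 2 * Y * (1 - kappa / 2 / Y).
Proof.
move=> k0 k1 Y1 b2 o0 rho_le o_le.
have Y0 : Y != 0 by apply/lt0r_neq0; lra.
set D := 1 + (Y - 1) * (1 - kappa) in rho_le.
have D1 : 1 <= D by rewrite /D; nra.
have DY : D <= Y by rewrite /D; nra.
have D0 : 0 < D by lra.
apply: le_trans (ler_wpM2r o0 rho_le) _.
rewrite mulrAC ler_pdivrMr //.
apply: le_trans (ler_wpM2l _ o_le) _; first lra.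
have -> : b ^+ 2 * Y * (1 - kappa / 2 / Y) * D =
  Y * ((1 - kappa) * (b ^+ 2 * Y) + kappa * b)
    + kappa * b * (b * (Y - D) / 2 + Y * (b - 2) / 2).
  by rewrite /D; field.
rewrite lerDl mulr_ge0 ?addr_ge0 ?divr_ge0 ?mulr_ge0 //; lra.
Qed.

Lemma prob_le (K : realType) (T : nat) (P Q : pred (T.-tuple bool)) :
  {subset P <= Q} -> prob K P <= prob K Q.
Proof.
move=> PQ; rewrite /prob ler_wpM2r ?invr_ge0 ?exprn_ge0 // ler_nat.
exact/subset_leq_card/subsetP.
Qed.

Lemma expect_ge (K : realType) (T : nat) (F : T.-tuple bool -> K) (v : K) :
  (forall w, 0 <= F w) -> v * (1 - prob K (fun w => F w < v)) <= expect F.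
Proof.
move=> F0; have twoT : 0 < 2 ^+ T :> K by rewrite exprn_gt0.
rewrite /prob /expect ler_pdivlMr // -mulrA mulrBl mul1r mulfVK ?lt0r_neq0 //.
have -> : 2 ^+ T = \sum_(w : T.-tuple bool) 1 :> K.
  by rewrite sumr_const card_tuple card_bool natrX.
rewrite -sum1_card natr_sum [X in _ - X]big_mkcond /= -sumrB mulr_sumr.
apply: ler_sum => w _; rewrite -topredE /=.
by case: ltP => Fv; rewrite ?subrr ?mulr0 // subr0 mulr1.
Qed.

Theorem theorem6 (R : realType) (kappa eps : R)
    (kappa_gt0 : 0 < kappa) (kappa_le1 : kappa <= 1) (eps_gt0 : 0 < eps) :
  ~ exists (A : program R) (c n0 : nat) (rho : nat -> R),
      [/\ polynomial_time kappa A c,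
          (forall n : nat, (n0 <= n)%N -> rho n < hardness_factor kappa eps n)
        & achieves kappa A c rho].
Proof.
move=> [A [c [n0 [rho [_ rho_lt ach]]]]].
have [k k_ge] : exists k : nat, 3 / (2 * k + 6)%:R <= eps.
  exists (Num.truncn (3 / eps)); rewrite ler_pdivrMr ?ltr0n; last by lia.
  rewrite mulrC -ler_pdivrMr //; apply: ltW; apply: lt_le_trans (truncnS_gt _) _.
  by rewrite ler_nat; move: (Num.truncn _) => t; lia.
have rho_opt (I : instance R) (b : nat) : admissible kappa I -> (1 < b)%N ->
    (n0 <= nv (gr I) <= b ^ (2 * k + 6))%N ->
    opt I <= (1 - kappa) * (b ^ k.+2)%:R + kappa * b%:R ->
    rho (nv (gr I)) * opt I <= (b ^ k.+2)%:R * (1 - kappa / 2 / (b ^ k)%:R).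
  move=> [_ [nn _ _ _ _]] b1 /andP[n0I Ib].
  have -> : (b ^ k.+2)%:R = b%:R ^+ 2 * (b ^ k)%:R :> R.
    by rewrite -natrX -natrM -expnD.
  have nI : (0 < nv (gr I))%N by apply: leq_ltn_trans (ltn_ord (src I)).
  have Y1 : 1 <= (b ^ k)%:R :> R by rewrite ler1n expn_gt0 ltnW.
  apply: scaled_opt_le => //; first by rewrite ler_nat.
    by apply: le_bigmin => [|X _]; apply: nn.
  apply: le_trans (ltW (rho_lt _ n0I)) _; apply: ratio_mono => //.
    by rewrite powR_gt0 // ltr0n.
  by apply: root_le_hidden_size k_ge _; rewrite nI.
case: ach => [ach|[p p0 ach]].
  have [|I [b [adm nI b1 oI bad]]] :=
    hidden_instance A c k n0 kappa_gt0 kappa_le1 (_ : 0 < kappa / 2).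
    by rewrite divr_gt0.
  have [cut Ele] := ach I adm.
  have [_ [nn _ _ _ _]] := adm.
  have := le_trans (expect_ge (b ^ k.+2)%:R (fun w => nn (output A I w)))
    (le_trans Ele (rho_opt I b adm b1 nI oI)).
  rewrite ler_pM2l ?ltr0n ?expn_gt0 ?(ltnW b1) // lerD2l lerN2 leNgt.
  move/negP; apply; apply: le_lt_trans bad; apply: prob_le => w.
  by rewrite -!topredE /= cut.
have [I [b [adm nI b1 oI bad]]] :=
  hidden_instance A c k n0 kappa_gt0 kappa_le1 p0.
suff : p < p by rewrite ltxx.
apply: le_lt_trans (ach I adm) _.
apply: lt_le_trans (_ : p / (b ^ k)%:R <= p); last first.
  by rewrite ler_pdivrMr ?ltr0n ?expn_gt0 ?(ltnW b1) // ler_peMr ?ler1n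
    ?expn_gt0 ?(ltnW b1) // ltW.
apply: le_lt_trans bad; apply: prob_le => w; rewrite -!topredE /=.
move=> /andP[-> cle] /=; apply: le_lt_trans cle _.
apply: le_lt_trans (rho_opt I b adm b1 nI oI) _.
rewrite gtr_pMr ?ltr0n ?expn_gt0 ?(ltnW b1) // gtrBl !divr_gt0 //.
by rewrite ltr0n expn_gt0 ltnW.
Qed.
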